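(* Let $a_1,a_2,a_3$ be algebraically independent parameters and let $f_{\mathrm{Bc}}(u)\in\mathbb Q[a_1,a_2,a_3][[u]]$ be the exponential of the Buchstaber genus. Then $$f_{\mathrm{Bc}}(u)\in\mathcal H_{\mathbb Z[a_1,\,12a_2,\,360a_3]}[[u]].$$ Moreover, $\mathbb Z[a_1,12a_2,360a_3]$ is the minimal Hurwitz coefficient ring of $f_{\mathrm{Bc}}$ among subrings of $\mathbb Q[a_1,a_2,a_3]$: every subring $R\subseteq\mathbb Q[a_1,a_2,a_3]$ with $f_{\mathrm{Bc}}\in\mathcal H_R[[u]]$ contains $\mathbb Z[a_1,12a_2,360a_3]$.
   Context: For a torsion-free commutative ring $R$, the set of Hurwitz series over $R$ is $$\mathcal H_R[[u]]=\left\{\sum_{n\ge0}c_n\frac{u^n}{n!}\in(R\otimes_{\mathbb Z}\mathbb Q)[[u]]\ \Big|\ c_n\in R\right\}.$$ The exponential of the Buchstaber genus is the compositional inverse of $g_{\mathrm{Bc}}(u)=\int_0^u\frac{dt}{\sqrt{1-a_1t^2+a_2t^4-a_3t^6}}$; equivalently it is the formal power series with $f_{\mathrm{Bc}}(0)=0$, $f_{\mathrm{Bc}}'(0)=1$ and $$f_{\mathrm{Bc}}'(u)=\sqrt{1-a_1f_{\mathrm{Bc}}(u)^2+a_2f_{\mathrm{Bc}}(u)^4-a_3f_{\mathrm{Bc}}(u)^6},$$ the square root having constant term $1$. *)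

(* Defs.v *)
From HB Require Import structures.
From mathcomp Require Import all_boot all_order all_algebra.
From mathcomp Require Import boolp classical_sets.
From mathcomp Require Import mpoly.
From mathcomp Require Import ring.

Set Implicit Arguments.
Unset Strict Implicit.
Unset Printing Implicit Defensive.

Import GRing.Theory Num.Theory.
Local Open Scope ring_scope.
Local Open Scope classical_set_scope.

(* [{fps A}] is the ring A[[u]]; the coercion to functions sends a series to   *)
(* its coefficients, so that [f n] is the coefficient of u^n.                  *)
Record fps (A : Type) := Fps { fps_coef :> nat -> A }.
Notation "{ 'fps' A }" := (fps A) (at level 0, format "{ 'fps'  A }").

Lemma fpsP (A : Type) (f g : {fps A}) : (forall n, f n = g n) <-> f = g.
Proof. by split=> [|-> //]; case: f g => f [g] /= /funext ->. Qed.

HB.instance Definition _ (A : Type) := gen_eqMixin {fps A}.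
HB.instance Definition _ (A : Type) := gen_choiceMixin {fps A}.

Section Zmodule.
Variable A : zmodType.
Implicit Types f g h : {fps A}.

Definition fps_zero : {fps A} := Fps (fun=> 0).
Definition fps_opp f : {fps A} := Fps (fun n => - f n).
Definition fps_add f g : {fps A} := Fps (fun n => f n + g n).

Fact fps_addA : associative fps_add.
Proof. by move=> f g h; apply/fpsP => n; exact: addrA. Qed.
Fact fps_addC : commutative fps_add.
Proof. by move=> f g; apply/fpsP => n; exact: addrC. Qed.
Fact fps_add0 : left_id fps_zero fps_add.
Proof. by move=> f; apply/fpsP => n; exact: add0r. Qed.
Fact fps_addN : left_inverse fps_zero fps_opp fps_add.
Proof. by move=> f; apply/fpsP => n; exact: addNr. Qed.

HB.instance Definition _ :=
  GRing.isZmodule.Build {fps A} fps_addA fps_addC fps_add0 fps_addN.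

Lemma coef_fps0 n : (0 : {fps A}) n = 0. Proof. by []. Qed.
Lemma coef_fpsD f g n : (f + g) n = f n + g n. Proof. by []. Qed.
Lemma coef_fpsN f n : (- f) n = - f n. Proof. by []. Qed.
Lemma coef_fpsB f g n : (f - g) n = f n - g n. Proof. by []. Qed.
Lemma coef_fpsMn f m n : (f *+ m) n = f n *+ m.
Proof. by elim: m => // m IH; rewrite !mulrS coef_fpsD IH. Qed.

Definition fps_deriv f : {fps A} := Fps (fun n => f n.+1 *+ n.+1).

End Zmodule.

Section Ring.
Variable A : comNzRingType.
Implicit Types f g h : {fps A}.

Definition fps_one : {fps A} := Fps (fun n => (n == 0%N)%:R).
Definition fps_mul f g : {fps A} :=
  Fps (fun n => \sum_(i < n.+1) f i * g (n - i)%N).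
Definition fps_scale a f : {fps A} := Fps (fun n => a * f n).

Fact fps_mulC : commutative fps_mul.
Proof.
move=> f g; apply/fpsP => n /=; rewrite (reindex_inj rev_ord_inj) /=.
by apply: eq_bigr => i _; rewrite subSS mulrC subKn // -ltnS.
Qed.

Let trunc n f : {poly A} := \poly_(i < n.+1) f i.

Let coef_trunc n f i : (i <= n)%N -> (trunc n f)`_i = f i.
Proof. by move=> le_in; rewrite coef_poly ltnS le_in. Qed.

Let coef_truncM n f g i :
  (i <= n)%N -> (trunc n f * trunc n g)`_i = fps_mul f g i.
Proof.
move=> le_in; rewrite coefM; apply: eq_bigr => j _.
by rewrite !coef_trunc // (leq_trans _ le_in) ?leq_subr // -ltnS.
Qed.

Fact fps_mulA : associative fps_mul.
Proof.
move=> f g h; apply/fpsP => n.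
transitivity ((trunc n f * (trunc n g * trunc n h))`_n).
  rewrite coefM; apply: eq_bigr => i _.
  by rewrite coef_truncM ?leq_subr // coef_trunc // -ltnS.
rewrite mulrA coefM; apply: eq_bigr => i _.
by rewrite coef_truncM ?coef_trunc ?leq_subr // -ltnS.
Qed.

Fact fps_mul1 : left_id fps_one fps_mul.
Proof.
move=> f; apply/fpsP => n /=.
by rewrite big_ord_recl subn0 mul1r big1 ?addr0 // => i _; rewrite mul0r.
Qed.

Fact fps_mulDl : left_distributive fps_mul +%R.
Proof.
move=> f g h; apply/fpsP => n; rewrite coef_fpsD -big_split /=.
by apply: eq_bigr => i _; rewrite mulrDl.
Qed.

Fact fps_oner_neq0 : fps_one != 0.
Proof. by apply/eqP => /fpsP /(_ 0%N) /eqP; rewrite oner_eq0. Qed.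

HB.instance Definition _ := GRing.Zmodule_isComNzRing.Build {fps A}
  fps_mulA fps_mulC fps_mul1 fps_mulDl fps_oner_neq0.

Fact fps_scaleA a b f : fps_scale a (fps_scale b f) = fps_scale (a * b) f.
Proof. by apply/fpsP => n; exact: mulrA. Qed.
Fact fps_scale1 : left_id 1 fps_scale.
Proof. by move=> f; apply/fpsP => n; exact: mul1r. Qed.
Fact fps_scaleDr : right_distributive fps_scale +%R.
Proof. by move=> a f g; apply/fpsP => n; exact: mulrDr. Qed.
Fact fps_scaleDl f : {morph fps_scale^~ f : a b / a + b}.
Proof. by move=> a b; apply/fpsP => n; exact: mulrDl. Qed.

HB.instance Definition _ := GRing.Zmodule_isLmodule.Build A {fps A}
  fps_scaleA fps_scale1 fps_scaleDr fps_scaleDl.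

Fact fps_scaleAl a f g : a *: (f * g) = a *: f * g.
Proof.
apply/fpsP => n; rewrite /= /fps_scale /= mulr_sumr.
by apply: eq_bigr => i _; rewrite mulrA.
Qed.

HB.instance Definition _ := GRing.Lmodule_isLalgebra.Build A {fps A} fps_scaleAl.

Lemma coef_fps1 n : (1 : {fps A}) n = (n == 0%N)%:R. Proof. by []. Qed.
Lemma coef_fpsM f g n : (f * g) n = \sum_(i < n.+1) f i * g (n - i)%N.
Proof. by []. Qed.
Lemma coef_fpsZ a f n : (a *: f) n = a * f n. Proof. by []. Qed.

Lemma coef0_fpsM f g : (f * g) 0%N = f 0%N * g 0%N.
Proof. by rewrite coef_fpsM big_ord1. Qed.

Lemma coef0_fpsX f k : (f ^+ k) 0%N = f 0%N ^+ k.
Proof. by elim: k => // k IH; rewrite !exprS coef0_fpsM IH. Qed.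

(* A square root is determined by its constant term 1 when 2 is invertible.    *)
Definition fps_sqrt1 (p s : {fps A}) : Prop := s 0%N = 1 /\ s ^+ 2 = p.

Definition buchstaber_exp (a1 a2 a3 : A) (f : {fps A}) : Prop :=
  [/\ f 0%N = 0, fps_deriv f 0%N = 1
    & fps_sqrt1 (1 - a1 *: f ^+ 2 + a2 *: f ^+ 4 - a3 *: f ^+ 6) (fps_deriv f)].

End Ring.

(* A torsion-free ring R embeds in R (x) Q. Here R is a subset of a Q-algebra  *)
(* A, in which R (x) Q is identified with the Q-span of R when R is a subring. *)
Definition hurwitz (A : comAlgType rat) (R : set A) : set {fps A} :=
  [set f | exists c : nat -> A,
     (forall n, R (c n)) /\ forall n, f n = (n`!%:R^-1 : rat) *: c n].

(* Z[v_0, ..., v_(n-1)]: the values at v of integer polynomials.               *)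
Definition adjoinZ (A : comNzRingType) (n : nat) (v : 'I_n -> A) : set A :=
  range (mmap (intr : int -> A) v : {mpoly int[n]} -> A).

Definition is_subring (A : comNzRingType) (R : set A) : Prop :=
  subring_closed (mem R).

Lemma adjoinZ_subring (A : comNzRingType) (n : nat) (v : 'I_n -> A) :
  is_subring (adjoinZ v).
Proof.
split=> [|_ _ /set_mem[p _ <-] /set_mem[q _ <-]|
          _ _ /set_mem[p _ <-] /set_mem[q _ <-]]; apply/mem_set.
- by exists 1; rewrite // rmorph1.
- by exists (p - q); rewrite // rmorphB.
- by exists (p * q); rewrite // rmorphM.
Qed.

Section Existence.
Variable A : comAlgType rat.
Variables a1 a2 a3 : A.
Implicit Types f g h : {fps A}.

Let natQ_inj n (x y : A) : x *+ n.+1 = y *+ n.+1 -> x = y.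
Proof.
rewrite -!(@scaler_nat rat) => /(congr1 (fun z => (n.+1%:R^-1 : rat) *: z)).
by rewrite /= !scalerA !mulVf ?pnatr_eq0 ?scale1r.
Qed.

Let eqto n f g := forall i, (i <= n)%N -> f i = g i.

Let eqtoM n f g f' g' : eqto n f f' -> eqto n g g' -> eqto n (f * g) (f' * g').
Proof.
move=> ef eg i le_in; rewrite !coef_fpsM; apply: eq_bigr => j _.
by rewrite ef ?eg // (leq_trans _ le_in) ?leq_subr // -ltnS.
Qed.

Let eqtoX n f f' k : eqto n f f' -> eqto n (f ^+ k) (f' ^+ k).
Proof. by move=> ef; elim: k => [|k IH] //; rewrite !exprS; apply: eqtoM. Qed.

Let P f := 1 - a1 *: f ^+ 2 + a2 *: f ^+ 4 - a3 *: f ^+ 6.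
Let G f := - (a1 *: f) + a2 *: f ^+ 3 *+ 2 - a3 *: f ^+ 5 *+ 3.

Let eqtoG n f g : eqto n f g -> eqto n (G f) (G g).
Proof.
move=> e i le_in.
have e3 := eqtoX 3 e le_in; have e5 := eqtoX 5 e le_in; have e1 := e i le_in.
by rewrite !(coef_fpsD, coef_fpsN, coef_fpsMn, coef_fpsZ) e1 e3 e5.
Qed.

Let derivD f g : fps_deriv (f + g) = fps_deriv f + fps_deriv g.
Proof. by apply/fpsP => n; exact: mulrnDl. Qed.
Let derivN f : fps_deriv (- f) = - fps_deriv f.
Proof. by apply/fpsP => n; exact: mulNrn. Qed.
Let derivZ a f : fps_deriv (a *: f) = a *: fps_deriv f.
Proof. by apply/fpsP => n /=; rewrite /fps_scale /= mulrnAr. Qed.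
Let deriv1 : fps_deriv (1 : {fps A}) = 0.
Proof. by apply/fpsP => n /=; rewrite mul0rn. Qed.

Let derivM f g : fps_deriv (f * g) = fps_deriv f * g + f * fps_deriv g.
Proof.
apply/fpsP => n; rewrite coef_fpsD !coef_fpsM.
have -> : fps_deriv (f * g) n
    = \sum_(i < n.+2) (f i * g (n.+1 - i)%N *+ i
                       + f i * g (n.+1 - i)%N *+ (n.+1 - i)).
  rewrite /fps_deriv /= -sumrMnl; apply: eq_bigr => i _.
  by rewrite -mulrnDr subnKC // -ltnS.
rewrite big_split /=; congr (_ + _).
  rewrite big_ord_recl mulr0n add0r; apply: eq_bigr => i _ /=.
  by rewrite subSS mulrnAl.
rewrite big_ord_recr /= subnn mulr0n addr0; apply: eq_bigr => i _ /=.
by rewrite -mulrnAr subSn // -ltnS.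
Qed.

Let derivX f k : fps_deriv (f ^+ k.+1) = fps_deriv f * f ^+ k *+ k.+1.
Proof.
elim: k => [|k IH]; first by rewrite expr1 expr0 mulr1 mulr1n.
rewrite exprS derivM IH [in RHS]mulrS; congr (_ + _).
by rewrite mulrnAr mulrCA -exprS.
Qed.

Let derivP f : fps_deriv (P f) = fps_deriv f * G f *+ 2.
Proof.
have sc a : exists c : {fps A}, forall g, a *: g = c * g.
  by exists a%:A => g; rewrite mulr_algl.
rewrite /P !(derivD, derivN, derivZ, derivX, deriv1) add0r /G.
have [c1 e1] := sc a1; have [c2 e2] := sc a2; have [c3 e3] := sc a3.
by rewrite !e1 !e2 !e3; ring.
Qed.

Let lead1_inj f g : f 0%N = 1 -> f * g = 0 -> g = 0.
Proof.
move=> f0 /fpsP fg; apply/fpsP => n; elim/ltn_ind: n => n IH.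
have := fg n; rewrite coef_fpsM big_ord_recl f0 mul1r subn0 big1 ?addr0 //.
by move=> i _; rewrite IH ?mulr0 //= /bump add1n; case: n {IH} i => [[]|n] i //;
   rewrite subSS ltnS leq_subr.
Qed.

Lemma buchstaber_exp_exists_unique : exists! f, buchstaber_exp a1 a2 a3 f.
Proof.
pose T f : {fps A} := Fps (fun n => match n with
  | 0 => 0 | 1 => 1 | m.+2 => ((m.+2 * m.+1)%:R^-1 : rat) *: G f m end).
have T2 f m : T f m.+2 *+ m.+2 *+ m.+1 = G f m.
  by rewrite -mulrnA -scaler_nat /= scalerA mulfV ?scale1r // pnatr_eq0.
have TS n f g : eqto n f g -> eqto n.+1 (T f) (T g).
  by move=> e [|[|i]] //= le_in; congr (_ *: _); apply: (eqtoG e); exact: ltnW.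
have bP f : buchstaber_exp a1 a2 a3 f <-> f = T f.
  split=> [[f0 f1 [_ f2]]|fT].
    have dd : fps_deriv (fps_deriv f) = G f.
      apply/eqP; rewrite -subr_eq0; apply/eqP; apply: (lead1_inj f1).
      apply/fpsP => n; apply: (@natQ_inj 1).
      rewrite coef_fps0 mul0rn -coef_fpsMn mulrBr mulrnBl -derivP /P -f2 derivX.
      by rewrite expr1 mulrC subrr.
    apply/fpsP => [] [|[|n]]; [exact: f0 | exact: f1 |].
    by apply: (@natQ_inj n.+1); apply: (@natQ_inj n); rewrite T2 -dd.
  have f0 : f 0%N = 0 by rewrite fT.
  have f1 : fps_deriv f 0%N = 1 by rewrite /fps_deriv fT.
  split=> //; split=> //; apply/eqP; rewrite -subr_eq0; apply/eqP.
  have dd : fps_deriv (fps_deriv f) = G f.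
    by apply/fpsP => n; rewrite -T2 -fT.
  set h := _ - _; have dh : fps_deriv h = 0.
    by rewrite /h derivD derivN -/(P f) derivP derivX expr1 dd mulrC subrr.
  apply/fpsP => [] [|n]; last first.
    by apply: (@natQ_inj n); move/fpsP: dh => /(_ n) /= ->; rewrite mul0rn.
  rewrite !(coef_fpsD, coef_fpsN, coef_fpsZ, coef0_fpsX) f0 f1.
  by rewrite !expr0n /= !mulr0 !subr0 !addr0 expr1n subrr.
pose F k := iter k T 0; pose f : {fps A} := Fps (fun n => F n.+1 n).
have FS k : eqto k (F k.+1) (F k.+2).
  by elim: k => [[]//|k IH]; apply: (TS).
have Ff n k : (n <= k)%N -> F k.+1 n = f n.
  move=> /subnK <-; elim: (k - n)%N => [|d IH] //.
  by rewrite -IH addSn -FS // leq_addl.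
exists f; split=> [|g].
  apply/bP/fpsP => n; transitivity (F n.+2 n); first by rewrite (Ff n n.+1).
  apply: (TS n) => // i le_in; exact: Ff.
move=> /bP gT; apply/fpsP => n.
have : eqto n (F n.+1) g.
  elim: n => [[|]//|n IH]; first by rewrite gT.
  by rewrite gT; apply: TS.
exact.
Qed.

End Existence.

(* Main.v *)
(* Differentiating the square of f' = sqrt(1 - a1 f^2 + a2 f^4 - a3 f^6) and   *)
(* cancelling 2 f' gives, with b2 = 12 a2 and b3 = 360 a3,                     *)
(*   f'' = - a1 f + b2 f^3/3! - b3 f^5/5!.                                     *)
(* Over any ring of coefficients the divided powers f^k/k! of a Hurwitz series *)
(* without constant term are Hurwitz, since (f^(k+1)/(k+1)!)' = f' f^k/k!. So  *)
(* the equation determines n! [u^n] f recursively inside Z[a1, b2, b3]. Read   *)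
(* backwards at u, u^3 and u^5, where f^k/k! starts with u^k/k!, it expresses  *)
(* a1, b2 and b3 through the Hurwitz coefficients of f.                        *)
From HB Require Import structures.
Require Import Defs.
From mathcomp Require Import all_boot all_order all_algebra.
From mathcomp Require Import boolp classical_sets.
From mathcomp Require Import mpoly.
From mathcomp Require Import ring.

Set Implicit Arguments.
Unset Strict Implicit.
Unset Printing Implicit Defensive.

Import GRing.Theory.
Local Open Scope ring_scope.
Local Open Scope classical_set_scope.

(** The equation is [buchstaber_ode]. Both directions concern an arbitrary subring [S]:
    [buchstaber_exp_hurwitz], resting on [hurwitz_upto_divpow], is used with [S] =
    Z[a1, 12 a2, 360 a3], and [buchstaber_params_mem] with [S] = [R]; [adjoinZ_sub] then passes from
    the generators to the whole ring. *)

Section Derivation.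
Variable A : comNzRingType.
Implicit Types f g : {fps A}.

Lemma fps_derivD f g : fps_deriv (f + g) = fps_deriv f + fps_deriv g.
Proof. by apply/fpsP => n; exact: mulrnDl. Qed.

Lemma fps_derivN f : fps_deriv (- f) = - fps_deriv f.
Proof. by apply/fpsP => n; exact: mulNrn. Qed.

Lemma fps_derivZ a f : fps_deriv (a *: f) = a *: fps_deriv f.
Proof. by apply/fpsP => n; symmetry; exact: mulrnAr. Qed.

Lemma fps_deriv1 : fps_deriv (1 : {fps A}) = 0.
Proof. by apply/fpsP => n; exact: mul0rn. Qed.

Lemma fps_derivM f g : fps_deriv (f * g) = fps_deriv f * g + f * fps_deriv g.
Proof.
apply/fpsP => n; rewrite coef_fpsD !coef_fpsM /=.
(* In the term of index i, the factor n+1 is split as i + (n+1-i). *)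
transitivity (\sum_(i < n.+2) (f i *+ i * g (n.+1 - i)%N
                               + f i * (g (n.+1 - i)%N *+ (n.+1 - i)))).
  rewrite -sumrMnl; apply: eq_bigr => -[i lt_in] _ /=.
  by rewrite mulrnAl mulrnAr -mulrnDr subnKC.
rewrite big_split /= big_ord_recl mulr0n mul0r add0r [X in _ + X]big_ord_recr /=.
rewrite subnn mulr0n mulr0 addr0.
by congr (_ + _); apply: eq_bigr => -[i lt_in] _ //=; rewrite subSn.
Qed.

Lemma fps_derivX f k : fps_deriv (f ^+ k.+1) = fps_deriv f * f ^+ k *+ k.+1.
Proof.
elim: k => [|k IH]; first by rewrite mulr1.
by rewrite exprS fps_derivM IH mulrnAr mulrCA -exprS -mulrS.
Qed.

(** The n-th coefficient of the product is g_n plus terms in earlier coefficients of g. This is what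
    allows f' to be cancelled. *)
Lemma fps_mul_lead1_eq0 f g : f 0%N = 1 -> f * g = 0 -> g = 0.
Proof.
move=> f0 /fpsP fg; apply/fpsP; elim/ltn_ind=> n IH.
have := fg n; rewrite coef_fpsM big_ord_recl f0 mul1r subn0 big1 ?addr0 //.
move=> [i lt_in] _ /=; rewrite IH ?mulr0 //.
by rewrite ltn_subrL /=; apply: leq_ltn_trans lt_in.
Qed.

Lemma coef_fpsX_lt f k n : f 0%N = 0 -> (n < k)%N -> (f ^+ k) n = 0.
Proof.
move=> f0; elim: k n => // k IH n lt_nk.
rewrite exprS coef_fpsM big_ord_recl f0 mul0r add0r big1 // => -[i lt_in] _ /=.
rewrite IH ?mulr0 // /bump add1n; case: n lt_nk lt_in => // n lt_nk _.
by rewrite subSS; apply: leq_ltn_trans (leq_subr _ _) _.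
Qed.

Lemma coef_fpsX_diag f k : f 0%N = 0 -> (f ^+ k) k = f 1%N ^+ k.
Proof.
move=> f0; elim: k => // k IH.
rewrite exprS coef_fpsM big_ord_recl f0 mul0r add0r big_ord_recl /= subSS subn0.
rewrite IH big1 ?addr0 -?exprS // => -[i lt_ik] _ /=.
rewrite coef_fpsX_lt ?mulr0 // /bump !add1n subSS.
by rewrite ltn_subrL /=; apply: leq_ltn_trans lt_ik.
Qed.

End Derivation.

Section Hurwitz.
Variable A : comAlgType rat.
Implicit Types f g : {fps A}.

Lemma rat_algebra_mulrnI n : injective (fun x : A => x *+ n.+1).
Proof.
move=> x y /(congr1 (fun z => (n.+1%:R^-1 : rat) *: z)).
by rewrite /= -!scaler_nat !scalerA mulVf ?Num.Theory.pnatr_eq0 ?scale1r.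
Qed.

(** Since n! is invertible, the coefficients c_n are forced to be n! f_n. *)
Lemma hurwitzP (S : set A) f :
  hurwitz S f <-> forall n, S (f n *+ n`!).
Proof.
have nf n : (n`!%:R : rat) != 0 by rewrite Num.Theory.pnatr_eq0 -lt0n fact_gt0.
split=> [[c [Sc fc]] n|Sf].
  by rewrite fc -scaler_nat scalerA mulfV // scale1r.
exists (fun n => f n *+ n`!); split=> // n.
by rewrite -scaler_nat scalerA mulVf // scale1r.
Qed.

(** The rational 1/k! is first sent into [A], because the scalars of [{fps A}] are the elements of
    [A]. *)
Definition fps_divpow f k : {fps A} := (k`!%:R^-1 : rat)%:A *: f ^+ k.

Lemma fps_divpowE f k n : fps_divpow f k n *+ k`! = (f ^+ k) n.
Proof.
rewrite /fps_divpow coef_fpsZ mulr_algl -scaler_nat scalerA mulfV ?scale1r //.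
by rewrite Num.Theory.pnatr_eq0 -lt0n fact_gt0.
Qed.

Lemma fps_divpow0 f : fps_divpow f 0 = 1.
Proof. by rewrite /fps_divpow invr1 !scale1r. Qed.

Lemma fps_deriv_divpow f k :
  fps_deriv (fps_divpow f k.+1) = fps_deriv f * fps_divpow f k.
Proof.
rewrite /fps_divpow fps_derivZ fps_derivX [RHS]mulrC -scalerAl.
rewrite [_ * fps_deriv f]mulrC -scalerMnr scalerMnl.
congr (_ *: _).
rewrite scalerMnl -mulr_natl factS natrM invfM mulrA mulfV ?mul1r //.
by rewrite Num.Theory.pnatr_eq0.
Qed.

Lemma fps_divpow_lt f k n : f 0%N = 0 -> (n < k)%N -> fps_divpow f k n = 0.
Proof. by move=> f0 lt_nk; rewrite coef_fpsZ coef_fpsX_lt ?mulr0. Qed.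

Variable S : subringClosed A.

(** Truncated at order n, so that the differential equation can serve as a recursion on the
    coefficients. *)
Definition hurwitz_upto n f := forall i, (i <= n)%N -> f i *+ i`! \in S.

Lemma hurwitz_uptoW m n f : (m <= n)%N -> hurwitz_upto n f -> hurwitz_upto m f.
Proof. by move=> le_mn Sf i le_im; apply: Sf; apply: leq_trans le_mn. Qed.

Lemma hurwitz_uptoD n f g :
  hurwitz_upto n f -> hurwitz_upto n g -> hurwitz_upto n (f + g).
Proof.
by move=> Sf Sg i le_in; rewrite coef_fpsD mulrnDl rpredD ?Sf ?Sg.
Qed.

Lemma hurwitz_uptoN n f : hurwitz_upto n f -> hurwitz_upto n (- f).
Proof. by move=> Sf i le_in; rewrite coef_fpsN mulNrn rpredN Sf. Qed.

Lemma hurwitz_uptoZ n a f :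
  a \in S -> hurwitz_upto n f -> hurwitz_upto n (a *: f).
Proof. by move=> Sa Sf i le_in; rewrite coef_fpsZ -mulrnAr rpredM ?Sf. Qed.

(** Hurwitz coefficients multiply by binomial convolution: i! = C(i,j) j! (i-j)!. *)
Lemma hurwitz_uptoM n f g :
  hurwitz_upto n f -> hurwitz_upto n g -> hurwitz_upto n (f * g).
Proof.
move=> Sf Sg i le_in; rewrite coef_fpsM -sumrMnl rpred_sum // => -[j lt_ji] _ /=.
rewrite -(@bin_fact i j) // mulnC mulrnA rpredMn // mulrnA -mulrnAl -mulrnAr.
by rewrite rpredM ?Sf ?Sg // (leq_trans _ le_in) // leq_subr.
Qed.

Lemma hurwitz_upto_deriv n f :
  hurwitz_upto n.+1 f -> hurwitz_upto n (fps_deriv f).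
Proof. by move=> Sf i le_in; rewrite /= -mulrnA -factS Sf. Qed.

Lemma hurwitz_upto_int n f :
  f 0%N \in S -> hurwitz_upto n (fps_deriv f) -> hurwitz_upto n.+1 f.
Proof. by move=> Sf0 Sf [|i] // le_in; rewrite factS mulrnA Sf. Qed.

(** Induction on k for all n: differentiation costs one order, and integrating f' f^k/k! regains it
    without introducing denominators. *)
Lemma hurwitz_upto_divpow n f k :
  f 0%N = 0 -> hurwitz_upto n f -> hurwitz_upto n (fps_divpow f k).
Proof.
move=> f0; elim: k n => [|k IH] n Sf.
  move=> i _; rewrite fps_divpow0 coef_fps1.
  by rewrite rpredMn // rpred_nat.
have d0 : fps_divpow f k.+1 0%N \in S by rewrite fps_divpow_lt ?rpred0.
case: n Sf => [|n] Sf; first by case.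
apply: hurwitz_upto_int => //; rewrite fps_deriv_divpow.
by apply: hurwitz_uptoM; [exact: hurwitz_upto_deriv | apply/IH/hurwitz_uptoW/Sf].
Qed.

End Hurwitz.

Section BuchstaberGenus.
Variables (A : comAlgType rat) (a1 a2 a3 : A) (f : {fps A}).
Hypothesis fB : buchstaber_exp a1 a2 a3 f.

Lemma buchstaber_ode :
  fps_deriv (fps_deriv f) =
    - (a1 *: f) + (12%:R * a2) *: fps_divpow f 3
                - (360%:R * a3) *: fps_divpow f 5.
Proof.
case: fB => f0 f1 [_ f2].
(* The constants come from 12 = 2 * 3! and, below, 360 = 3 * 5!. *)
have -> : (12%:R * a2) *: fps_divpow f 3 = a2 *: f ^+ 3 *+ 2.
  by apply/fpsP=> n; rewrite coef_fpsMn [LHS]coef_fpsZ (coef_fpsZ a2)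
    -fps_divpowE -[3`!]/6%N; ring.
have -> : (360%:R * a3) *: fps_divpow f 5 = a3 *: f ^+ 5 *+ 3.
  by apply/fpsP=> n; rewrite coef_fpsMn [LHS]coef_fpsZ (coef_fpsZ a3)
    -fps_divpowE -[5`!]/120%N; ring.
apply/eqP; rewrite -subr_eq0; apply/eqP; apply: fps_mul_lead1_eq0 f1 _.
set h := fps_deriv f * _; suff h0 : h *+ 2 = 0.
  apply/fpsP => n; apply: (@rat_algebra_mulrnI A 1).
  by rewrite mul0rn -coef_fpsMn h0.
rewrite /h.
move/(congr1 (@fps_deriv A)): f2.
rewrite !(fps_derivD, fps_derivN, fps_derivZ, fps_derivX, fps_deriv1).
(* The right-hand 0 becomes the difference of the two sides of the differentiated equation, leaving
   a polynomial identity. *)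
move/eqP; rewrite -subr_eq0 => /eqP <-.
(* Scalings become products with constant series, to suit [ring]. *)
have scaleE a : exists c : {fps A}, forall g, a *: g = c * g.
  by exists a%:A => g; rewrite mulr_algl.
have [[c1 e1] [c2 e2] [c3 e3]] := And3 (scaleE a1) (scaleE a2) (scaleE a3).
rewrite !e1 !e2 !e3; ring.
Qed.

Section Coefficients.
Variable S : subringClosed A.

Lemma buchstaber_exp_hurwitz :
    a1 \in S -> 12%:R * a2 \in S -> 360%:R * a3 \in S ->
  forall n, f n *+ n`! \in S.
Proof.
move=> S1 S2 S3; case: fB => f0 f1 _ n.
suff: hurwitz_upto S n.+1 f by apply; apply: leqnSn.
elim: n => [|n IH].
  by case=> [|[|i]] // _; [rewrite f0 rpred0 | rewrite (f1 : f 1%N *+ 1 = 1) rpred1].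
(* Order n of f controls order n of f'', and two integrations then reach order n+2. *)
have Sf := hurwitz_uptoW (leqnSn n) IH.
apply: hurwitz_upto_int; first by rewrite f0 rpred0.
apply: hurwitz_upto_int; first by rewrite f1 rpred1.
rewrite buchstaber_ode; apply: hurwitz_uptoD; first apply: hurwitz_uptoD.
- by apply/hurwitz_uptoN/hurwitz_uptoZ.
- by apply: hurwitz_uptoZ => //; apply: hurwitz_upto_divpow.
- by apply/hurwitz_uptoN/hurwitz_uptoZ => //; apply: hurwitz_upto_divpow.
Qed.

Lemma buchstaber_params_mem : (forall n, f n *+ n`! \in S) ->
  [/\ a1 \in S, 12%:R * a2 \in S & 360%:R * a3 \in S].
Proof.
move=> Sf; case: fB => f0 f1 _.
have Sg k n : fps_divpow f k n *+ n`! \in S.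
  by apply: (@hurwitz_upto_divpow A S n) => // i _.
have gk k : fps_divpow f k k *+ k`! = 1.
  by rewrite fps_divpowE coef_fpsX_diag // (f1 : f 1%N = 1) expr1n.
have rec n : f n.+2 *+ n.+2`! = - (a1 * (f n *+ n`!))
    + (12%:R * a2) * (fps_divpow f 3 n *+ n`!)
    - (360%:R * a3) * (fps_divpow f 5 n *+ n`!).
  have f2 : f n.+2 *+ n.+2 *+ n.+1 = fps_deriv (fps_deriv f) n by [].
  rewrite !factS 2!mulrnA f2 buchstaber_ode.
  rewrite !(coef_fpsD, coef_fpsN) !mulrnDl !mulNrn.
  by rewrite (coef_fpsZ a1) (coef_fpsZ (_ * a2)) (coef_fpsZ (_ * a3)) -!mulrnAr.
(* With c_n = n! f_n, the indices 3, 5, 7 give a triangular system: c_3 = -a1, c_5 = -a1 c_3 + b2,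
   and c_7 is -b3 plus terms already known to lie in [S]. *)
have S1 : a1 \in S.
  have := Sf 3; rewrite rec !fps_divpow_lt // !mul0rn !mulr0 subr0 addr0 rpredN.
  by rewrite (f1 : f 1%N *+ 1 = 1) mulr1.
have S2 : 12%:R * a2 \in S.
  have := Sf 5; rewrite rec gk mulr1 fps_divpow_lt // mul0rn mulr0 subr0.
  by rewrite rpredDl // rpredN rpredM.
split=> //; have := Sf 7; rewrite rec gk mulr1.
rewrite rpredDl ?rpredN //.
by apply: rpredD; [rewrite rpredN|]; apply: rpredM.
Qed.

End Coefficients.
End BuchstaberGenus.

Lemma adjoinZ_gen (A : comNzRingType) n (v : 'I_n -> A) i : adjoinZ v (v i).
Proof. by exists 'X_i; rewrite // mmapX mmap1U. Qed.

(** The value of an integer polynomial is a sum of integer multiples of monomials in the [v i]. *)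
Lemma adjoinZ_sub (A : comNzRingType) n (v : 'I_n -> A) (S : subringClosed A) :
  (forall i, v i \in S) -> adjoinZ v `<=` [set x | x \in S].
Proof.
move=> Sv _ [p _ <-] /=; rewrite /mmap rpred_sum // => m _.
by rewrite rpredM ?rpred_int // rpred_prod // => i _; rewrite rpredX.
Qed.

Theorem theorem5p2 :
  let a1 : {mpoly rat[3]} := 'X_0 in
  let a2 : {mpoly rat[3]} := 'X_1 in
  let a3 : {mpoly rat[3]} := 'X_2 in
  let Z_a : set {mpoly rat[3]} :=
    adjoinZ (tnth [tuple a1; 12%:R * a2; 360%:R * a3]) in
  forall f : {fps {mpoly rat[3]}}, buchstaber_exp a1 a2 a3 f ->
    hurwitz Z_a f /\
    (is_subring Z_a /\
     forall R : set {mpoly rat[3]}, is_subring R -> hurwitz R f -> Z_a `<=` R).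
Proof.
move=> a1 a2 a3 Z_a f fB.
have Zsub : is_subring Z_a by exact: adjoinZ_subring.
have gen i : tnth [tuple a1; 12%:R * a2; 360%:R * a3] i \in Z_a.
  by apply/mem_set; exact: adjoinZ_gen.
split; [|split=> // R Rsub].
  (* The set is repackaged as a subring predicate, the form the preceding lemmas take. *)
  pose S : subringClosed {mpoly rat[3]} := HB.pack (fun x => x \in Z_a)
    (GRing.isSubringClosed.Build _ _ Zsub).
  apply/hurwitzP => n; apply/set_mem.
  apply: (buchstaber_exp_hurwitz fB (S := S)).
  - exact: (gen 0).
  - exact: (gen 1).
  - exact: (gen 2).
pose S : subringClosed {mpoly rat[3]} := HB.pack (fun x => x \in R)
  (GRing.isSubringClosed.Build _ _ Rsub).
move=> /hurwitzP Rf x Zx; apply/set_mem.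
have [|S1 S2 S3] := buchstaber_params_mem fB (S := S).
  by move=> n; apply/mem_set.
apply: (@adjoinZ_sub _ _ _ S _ x Zx).
by case=> [[|[|[|]]]].
Qed.
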